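(* Let $N\ge 3$ and $1<p<2^*-1$, where $2^*-1=\frac{N+2}{N-2}$. Then the problem $$\nabla\cdot\left[\frac{\nabla u}{\sqrt{1-|\nabla u|^2}}\right]+u^p=0\ \text{ in }\mathbb{R}^N,\qquad u(x)>0\ \text{ in }\mathbb{R}^N,\qquad u(x)\to 0\ \text{ as }|x|\to\infty$$ has no radial solution.
   Context: Here $2^*=\frac{2N}{N-2}$. Solutions are understood in the classical sense, with $|\nabla u|<1$ everywhere. A radial function $u$ on $\mathbb{R}^N$ is identified with a function of $r=|x|$; radial solutions correspond to global positive functions $u(r)$, $r\ge 0$, vanishing at infinity, with $|u'|<1$, $u'(0)=0$ and $$\left(\frac{u'}{\sqrt{1-(u')^2}}\right)'+\frac{N-1}{r}\frac{u'}{\sqrt{1-(u')^2}}+u^p=0\quad\text{for } r>0.$$ *)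

(* Defs.v *)
From HB Require Import structures.
From mathcomp Require Import all_boot all_order all_algebra.
From mathcomp Require Import all_classical all_reals all_analysis.

Set Implicit Arguments.
Unset Strict Implicit.
Unset Printing Implicit Defensive.

Import Order.TTheory GRing.Theory Num.Theory.
Import numFieldNormedType.Exports.

Local Open Scope classical_set_scope.
Local Open Scope ring_scope.

(* The library norm on 'rV[R]_N is the sup norm: it gives the right topology,
   but |x| and |grad u| have to be Euclidean. *)
Definition enorm (R : realType) (N : nat) (x : 'rV[R]_N) : R :=
  Num.sqrt (\sum_(i < N) x 0 i ^+ 2).

Definition partial (R : realType) (N : nat) (i : 'I_N) (f : 'rV[R]_N -> R)
    (x : 'rV[R]_N) : R :=
  'D_(delta_mx 0 i) f x.

Definition grad (R : realType) (N : nat) (f : 'rV[R]_N -> R)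
    (x : 'rV[R]_N) : 'rV[R]_N :=
  \row_i partial i f x.

Definition div (R : realType) (N : nat) (F : 'rV[R]_N -> 'rV[R]_N)
    (x : 'rV[R]_N) : R :=
  \sum_(i < N) partial i (fun y => F y 0 i) x.

Fixpoint is_Ck (R : realType) (N : nat) (k : nat) (f : 'rV[R]_N -> R) : Prop :=
  continuous f /\
  if k is j.+1 then
    forall i : 'I_N,
      (forall x, derivable f x (delta_mx 0 i)) /\ is_Ck j (partial i f)
  else True.

Definition mean_curvature_flux (R : realType) (N : nat) (u : 'rV[R]_N -> R)
    (x : 'rV[R]_N) : 'rV[R]_N :=
  (Num.sqrt (1 - enorm (grad u x) ^+ 2))^-1 *: grad u x.

Definition vanishes_at_infinity (R : realType) (N : nat)
    (u : 'rV[R]_N -> R) : Prop :=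
  forall e : R, 0 < e ->
    exists M : R, forall x : 'rV[R]_N, M < enorm x -> `|u x| < e.

Definition radial (R : realType) (N : nat) (u : 'rV[R]_N -> R) : Prop :=
  exists f : R -> R, forall x : 'rV[R]_N, u x = f (enorm x).

Record is_classical_solution (R : realType) (N : nat) (p : R)
    (u : 'rV[R]_N -> R) : Prop := IsClassicalSolution {
  solution_C2 : is_Ck 2 u;
  solution_spacelike : forall x, enorm (grad u x) < 1;
  solution_equation : forall x, div (mean_curvature_flux u) x + u x `^ p = 0;
  solution_positive : forall x, 0 < u x;
  solution_vanishes : vanishes_at_infinity u
}.

(* Main.v *)
(** Write a radial solution as [g(r)], with [v = g'] and [Q = 1 / sqrt(1 - v^2)].
    The function
    [P = r^N (Q - 1 + g^(p+1) / (p+1)) + N / (p+1) r^(N-1) v Q g]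
    vanishes at 0 and, by the Pohozaev identity and subcriticality, is strictly
    increasing.  On the other hand integrating the equation gives
    [- v Q >= r g^p / N], the energy bounds [Q], and hence
    [g <= C r^(-2/(p-1))].  The mean value theorem on [[r, 2r]] yields a point [s]
    with [|v(s)| <= g(r) / r], so that [P(s) <= C r^(N-2) g(r)^2], which tends
    to 0 because [p < (N+2)/(N-2)]: a contradiction. *)

Require Import Defs.
From mathcomp Require Import all_boot all_order all_algebra.
From mathcomp Require Import all_classical all_reals all_analysis.
From mathcomp Require Import ring lra.

Import Order.TTheory GRing.Theory Num.Theory.
Import numFieldNormedType.Exports.

Local Open Scope ring_scope.

(** * Differentiation rules and monotonicity on the real line *)

Section PointwiseDerivatives.
Set Implicit Arguments.
Unset Strict Implicit.
Variable R : realType.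
Implicit Types (f g : R -> R) (x a b : R).

Lemma is_derive_add f g x a b : is_derive x 1 f a -> is_derive x 1 g b ->
  is_derive x 1 (fun y => f y + g y) (a + b).
Proof. by move=> fa gb; exact: is_deriveD. Qed.

Lemma is_derive_mul f g x a b : is_derive x 1 f a -> is_derive x 1 g b ->
  is_derive x 1 (fun y => f y * g y) (a * g x + f x * b).
Proof.
move=> fa gb; apply: (@is_derive_eq _ _ _ (f * g)).
by rewrite /GRing.scale /= addrC mulrC.
Qed.

Lemma is_derive_scale c f x a : is_derive x 1 f a ->
  is_derive x 1 (fun y => c * f y) (c * a).
Proof. by move=> fa; exact: is_deriveZ. Qed.

Lemma is_derive_pow n x : is_derive x 1 (fun y : R => y ^+ n) (n%:R * x ^+ n.-1).
Proof.
have -> : (fun y : R => y ^+ n) = id ^+ n.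
  by apply/boolp.funext => y; rewrite exprfctE.
by apply: is_derive_eq; rewrite /GRing.scale /= mulr1.
Qed.

Lemma is_derive_powR q f x a : 0 < f x -> is_derive x 1 f a ->
  is_derive x 1 (fun y => f y `^ q) (q * f x `^ (q - 1) * a).
Proof.
move=> fx0 fa.
exact: (@is_derive1_comp _ (fun y => y `^ q) f _ _ _ (is_derive1_powR q fx0) fa).
Qed.

Lemma is_derive_within_continuous f (df : R -> R) (A : set R) :
  (forall x, is_derive x 1 f (df x)) -> {within A, continuous f}%classic.
Proof.
move=> fdf; apply: continuous_subspaceT => x.
exact/differentiable_continuous/derivable1_diffP/(@ex_derive _ _ _ _ _ _ _ (fdf x)).
Qed.

(** The sign of [df] is asked only strictly to the right of [x], so that [x] can be the origin,
    where the radial equation is singular. *)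
Lemma is_derive_le f (df : R -> R) x y : (forall x, is_derive x 1 f (df x)) ->
  x <= y -> (forall z, x < z -> df z <= 0) -> f y <= f x.
Proof.
move=> fdf; rewrite le_eqVlt => /predU1P[-> //|xy] df0.
have [c] := MVT xy (fun z _ => fdf z) (is_derive_within_continuous fdf).
rewrite in_itv /= => /andP[xc _] E.
by rewrite -subr_le0 E mulr_le0_ge0 ?df0// subr_ge0 ltW.
Qed.

Lemma is_derive_lt f (df : R -> R) x y : (forall x, is_derive x 1 f (df x)) ->
  x < y -> (forall z, x < z -> df z < 0) -> f y < f x.
Proof.
move=> fdf xy df0.
have [c] := MVT xy (fun z _ => fdf z) (is_derive_within_continuous fdf).
rewrite in_itv /= => /andP[xc _] E.
by rewrite -subr_lt0 E nmulr_rlt0 ?df0// subr_gt0.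
Qed.

End PointwiseDerivatives.

(** * Nonexistence for the radial ordinary differential equation *)

Section RadialODE.
Set Implicit Arguments.
Unset Strict Implicit.
(* The space dimension is [k + 2]; [v = g'], [a = g''] and [Q] is the Lorentz
   factor [1 / sqrt(1 - v^2)]. *)
Variables (R : realType) (k : nat) (p : R) (g v a Q : R -> R).
Implicit Types r s z q : R.
Hypotheses (p1 : 1 < p) (pk : p * k%:R < k%:R + 4).
Hypotheses (dg : forall r : R, is_derive r 1 g (v r))
  (dv : forall r : R, is_derive r 1 v (a r))
  (dQ : forall r : R, is_derive r 1 Q (v r * a r * Q r ^+ 3)).
Hypotheses (g0 : forall r, 0 < g r) (Q0 : forall r, 0 < Q r)
  (Qv : forall r, Q r ^+ 2 * (1 - v r ^+ 2) = 1).
Hypothesis ode : forall r, 0 < r ->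
  a r * Q r ^+ 3 + k.+1%:R / r * (v r * Q r) + g r `^ p = 0.

Let flux r := r ^+ k.+1 * (v r * Q r).

Let ode_mul r : 0 < r ->
  r * (a r * Q r ^+ 3) = - (k.+1%:R * (v r * Q r)) - r * g r `^ p.
Proof.
move=> r0; have /(congr1 (fun x => r * x)) := ode r0.
rewrite mulr0 !mulrDr => E.
have E2 : r * (k.+1%:R / r * (v r * Q r)) = k.+1%:R * (v r * Q r).
  by field; rewrite gt_eqF.
by rewrite E2 in E; lra.
Qed.

Let flux_derive (r : R) : is_derive r 1 flux
  (k.+1%:R * r ^+ k * (v r * Q r) + r ^+ k.+1 * (a r * Q r ^+ 3)).
Proof.
have := is_derive_mul (is_derive_pow k.+1 r) (is_derive_mul (dv r) (dQ r)).
move/is_derive_eq; apply; congr (_ + _ * _).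
(* Since [Q^2 v^2 = Q^2 - 1], the derivative of [v Q] collapses to [a Q^3]. *)
have -> : a r * Q r + v r * (v r * a r * Q r ^+ 3) =
  a r * Q r * (1 + Q r ^+ 2 * v r ^+ 2) by ring.
by have := Qv r => E; rewrite (_ : Q r ^+ 2 * v r ^+ 2 = Q r ^+ 2 - 1); [ring|lra].
Qed.

Let fluxE r : 0 < r ->
  k.+1%:R * r ^+ k * (v r * Q r) + r ^+ k.+1 * (a r * Q r ^+ 3) =
  - (r ^+ k.+1 * g r `^ p).
Proof. by move=> r0; rewrite exprSr -(mulrA _ r (a r * _)) ode_mul//; ring. Qed.

Let gp r q : 0 < g r `^ q. Proof. exact: powR_gt0. Qed.

Let flux0 : flux 0 = 0. Proof. by rewrite /flux exprS !mul0r. Qed.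

Let flux_lt0 r : 0 < r -> flux r < 0.
Proof.
move=> r0; rewrite -flux0; apply: (is_derive_lt flux_derive r0) => z z0.
by rewrite fluxE// oppr_lt0 mulr_gt0 ?exprn_gt0.
Qed.

Lemma ode_decreasing r : 0 < r -> v r < 0.
Proof.
move=> r0; have := flux_lt0 r0.
by rewrite /flux pmulr_rlt0 ?exprn_gt0// pmulr_llt0.
Qed.

Let gD r q s : g r `^ (q + s) = g r `^ q * g r `^ s.
Proof. by rewrite powRD// (gt_eqF (g0 r)) implybT. Qed.

Let gM r q : g r * g r `^ q = g r `^ (1 + q).
Proof. by rewrite gD powRr1// ltW. Qed.

(* [r^(k+1) v Q = - \int_0^r s^(k+1) g^p ds] and [g] is nonincreasing. *)
Lemma ode_slope r : 0 < r -> r * g r `^ p <= k.+2%:R * (- v r * Q r).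
Proof.
move=> r0.
(* No integral is formed: [flux + r^(k+2) g^p / (k+2)] vanishes at 0, and by the equation only the
   term with [p g^(p-1) v <= 0] survives in its derivative. *)
have H z := is_derive_add (flux_derive z) (is_derive_scale k.+2%:R^-1
  (is_derive_mul (is_derive_pow k.+2 z) (is_derive_powR p (g0 z) (dg z)))).
have /= := is_derive_le H (ltW r0).
rewrite flux0 expr0n /= mul0r mulr0 addr0 => Hle.
have : flux r + k.+2%:R^-1 * (r ^+ k.+2 * g r `^ p) <= 0.
  apply: Hle => z z0; rewrite fluxE// (exprS z k.+1) /=.
  set c := k.+2%:R; have c0 : c != 0 by rewrite /c pnatr_eq0.
  have -> : - (z ^+ k.+1 * g z `^ p) + c^-1 * (c * (z ^+ k.+1) * g z `^ p +
     z * z ^+ k.+1 * (p * g z `^ (p - 1) * v z)) =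
     c^-1 * (z * z ^+ k.+1 * (p * g z `^ (p - 1))) * v z by field.
  rewrite mulr_ge0_le0// ?(ltW (ode_decreasing z0))//.
  rewrite !mulr_ge0 ?invr_ge0 ?ler0n ?exprn_ge0 ?powR_ge0 ?(ltW z0)//.
  exact: le_trans ler01 (ltW p1).
rewrite /flux (exprSr r k.+1) -mulrA (mulrCA k.+2%:R^-1) -mulrDr pmulr_rle0 ?exprn_gt0// => h.
have c0 : 0 < k.+2%:R :> R by rewrite ltr0n.
have : k.+2%:R * (v r * Q r + k.+2%:R^-1 * (r * g r `^ p)) <= 0 by rewrite pmulr_rle0.
by rewrite mulrDr mulVKf ?gt_eqF//; lra.
Qed.

(** * Energy dissipation and decay of the profile *)

Let energy r := (Q r - 1) + (p + 1)^-1 * g r `^ (p + 1).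

Let energy_derive (r : R) : is_derive r 1 energy (v r * a r * Q r ^+ 3 + g r `^ p * v r).
Proof.
have := is_derive_add (is_derive_add (dQ r) (is_derive_cst (-1 : R) r 1))
  (is_derive_scale (p + 1)^-1 (is_derive_powR (p + 1) (g0 r) (dg r))).
move/is_derive_eq; apply; rewrite addr0 addrK; congr (_ + _).
by rewrite mulrA mulKf// gt_eqF//; have := p1; lra.
Qed.

Let energyE r : 0 < r -> r * (v r * a r * Q r ^+ 3 + g r `^ p * v r) =
  - (k.+1%:R * (v r ^+ 2 * Q r)).
Proof.
move=> r0; have -> : r * (v r * a r * Q r ^+ 3 + g r `^ p * v r) =
  v r * (r * (a r * Q r ^+ 3) + r * g r `^ p) by ring.
by rewrite ode_mul//; ring.
Qed.

Let Kb := energy 0 + 1.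

(** With [r] as time, [Q - 1] is a relativistic kinetic energy and the power of [g] a nonnegative
    potential. The first-order term of the equation acts as friction, so the energy never exceeds
    its initial value. *)
Lemma ode_lorentz_bound r : 0 <= r -> Q r <= Kb.
Proof.
move=> r0; have : energy r <= energy 0.
  apply: (is_derive_le energy_derive r0) => z z0.
  rewrite -(pmulr_rle0 _ z0) energyE// oppr_le0.
  by rewrite mulr_ge0// mulr_ge0 ?sqr_ge0// ltW.
rewrite /Kb /energy => h.
have : 0 <= (p + 1)^-1 * g r `^ (p + 1).
  by rewrite mulr_ge0 ?invr_ge0 ?powR_ge0//; have := p1; lra.
lra.
Qed.

Let Kb0 : 0 < Kb. Proof. exact: lt_le_trans (Q0 0) (ode_lorentz_bound (lexx 0)). Qed.

Let k1E : k.+1%:R = k%:R + 1 :> R. Proof. by rewrite natr1. Qed.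
Let k2E : k.+2%:R = k%:R + 2 :> R. Proof. by rewrite -addn2 natrD. Qed.

Let c0 := (p - 1) / (k.+2%:R * Kb * 2).

Let c0_gt0 : 0 < c0.
Proof. by rewrite divr_gt0 ?mulr_gt0// subr_gt0. Qed.

(** Once [Q <= Kb], [ode_slope] bounds [- v g^(-p)] below by a multiple of [r], and
    [(p - 1) (- v) g^(-p)] is the derivative of [g^(1-p)]. The constant [c0] makes the derivative of
    [c0 r^2] equal to the resulting lower bound. As [1 - p < 0], this is an upper bound on [g]. *)
Lemma ode_decay r : 0 <= r -> c0 * r ^+ 2 <= g r `^ (1 - p).
Proof.
move=> r0.
have H z := is_derive_add (is_derive_scale c0 (is_derive_pow 2 z))
  (is_derive_scale (-1) (is_derive_powR (1 - p) (g0 z) (dg z))).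
have /= := is_derive_le H r0.
rewrite expr0n /= mulr0 add0r => Hle.
suff : c0 * r ^+ 2 + -1 * g r `^ (1 - p) <= -1 * g 0 `^ (1 - p).
  by have := gp 0 (1 - p); lra.
apply: Hle => z z0; rewrite expr1 addrAC subrr add0r.
have kK : 0 < k.+2%:R * Kb by rewrite mulr_gt0.
have slope : z * g z `^ p <= (k.+2%:R * Kb) * - v z.
  apply: (le_trans (ode_slope z0)); rewrite -mulrA ler_pM2l ?ltr0n//.
  rewrite mulrC ler_pM2r ?oppr_gt0 ?ode_decreasing//.
  by rewrite ode_lorentz_bound// ltW.
have {}slope : z <= (k.+2%:R * Kb) * (- v z * g z `^ (- p)).
  move: slope; rewrite -(ler_pM2r (gp z (- p))) -(mulrA z) -gD.
  by rewrite subrr powRr0 mulr1 -(mulrA (k.+2%:R * Kb)).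
have -> : c0 * (2 * z) = (p - 1) * (z / (k.+2%:R * Kb)).
  by rewrite /c0; field; rewrite !gt_eqF.
have : z / (k.+2%:R * Kb) <= - v z * g z `^ (- p) by rewrite ler_pdivrMr// mulrC.
have p10 : 0 <= p - 1 by rewrite subr_ge0 ltW.
move=> /(ler_wpM2l p10); set t := z / _.
lra.
Qed.

(** * The Pohozaev function and its monotonicity *)

Let b := k.+2%:R / (p + 1).
Let pohozaev r := r ^+ k.+2 * energy r + b * (flux r * g r).

Let pohozaev_derive (r : R) : is_derive r 1 pohozaev
  (k.+2%:R * r ^+ k.+1 * energy r +
   r ^+ k.+2 * (v r * a r * Q r ^+ 3 + g r `^ p * v r) +
   b * ((k.+1%:R * r ^+ k * (v r * Q r) + r ^+ k.+1 * (a r * Q r ^+ 3)) * g r +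
        flux r * v r)).
Proof.
exact: is_derive_add (is_derive_mul (is_derive_pow k.+2 r) (energy_derive r))
  (is_derive_scale b (is_derive_mul (flux_derive r) (dg r))).
Qed.

Let Q_gt1 r : 0 < r -> 1 < Q r.
Proof.
move=> r0; have v0 := ode_decreasing r0; have := Q0 r; have := Qv r.
nra.
Qed.

(* This is where subcriticality enters: it says exactly that [k / 2 < b]. *)
Lemma ode_pohozaev_increasing r s : 0 <= r -> r < s -> pohozaev r < pohozaev s.
Proof.
move=> r0 rs; rewrite -ltrN2.
have H z : is_derive z 1 (fun y => - pohozaev y) _ := is_deriveN (pohozaev_derive z).
apply: (is_derive_lt H rs) => z rz; have z0 := le_lt_trans r0 rz.
rewrite oppr_lt0 fluxE//.
have -> : z ^+ k.+2 * (v z * a z * Q z ^+ 3 + g z `^ p * v z) =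
  z ^+ k.+1 * - (k.+1%:R * (v z ^+ 2 * Q z)).
  by rewrite exprSr -mulrA energyE.
have -> : k.+2%:R * z ^+ k.+1 * energy z =
  z ^+ k.+1 * (k.+2%:R * (Q z - 1) + b * (g z `^ p * g z)).
  by rewrite /energy /b (addrC p 1) -gM; ring.
rewrite /flux.
(* The weight [b] is the one for which the terms in [g^(p+1)] cancel. *)
have -> : z ^+ k.+1 * (k.+2%:R * (Q z - 1) + b * (g z `^ p * g z)) +
   z ^+ k.+1 * - (k.+1%:R * (v z ^+ 2 * Q z)) +
   b * (- (z ^+ k.+1 * g z `^ p) * g z + z ^+ k.+1 * (v z * Q z) * v z) =
   z ^+ k.+1 * (k.+2%:R * (Q z - 1) - (k.+1%:R - b) * (v z ^+ 2 * Q z)) by ring.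
rewrite mulr_gt0 ?exprn_gt0// subr_gt0.
have bk : k%:R < 2 * b.
  by rewrite /b mulrA ltr_pdivlMr; [rewrite k2E; have := pk; lra|have := p1; lra].
have Q1 := Q_gt1 z0.
(* After multiplication by [Q], [v^2 Q^2 = (Q - 1) (Q + 1)] lets the positive factor [Q - 1] be
   divided out. What remains follows from [k + 1 - b < (k + 2) / 2] and [Q + 1 <= 2 Q]. *)
rewrite -(ltr_pM2r (Q0 z)).
have -> : (k.+1%:R - b) * (v z ^+ 2 * Q z) * Q z =
  (k.+1%:R - b) * ((Q z - 1) * (Q z + 1)).
  rewrite -!mulrA; congr (_ * _); have := Qv z; lra.
rewrite -mulrA mulrCA [X in _ < X]mulrCA ltr_pM2l ?subr_gt0//.
have kb : k.+1%:R - b < k.+2%:R / 2 by rewrite k1E k2E; lra.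
have : (k.+1%:R - b) * (Q z + 1) < k.+2%:R / 2 * (Q z + 1) by rewrite ltr_pM2r//; lra.
have : 0 <= k.+2%:R * (Q z - 1) by rewrite mulr_ge0// subr_ge0 ltW.
lra.
Qed.

Let pohozaev0 : pohozaev 0 = 0.
Proof. by rewrite /pohozaev flux0 exprS !mul0r mulr0 addr0. Qed.

Let delta_gt0 : 0 < pohozaev 1.
Proof. by rewrite -pohozaev0 ode_pohozaev_increasing. Qed.

(** * Upper bounds at large radii and the contradiction *)

Let g_noninc r s : 0 < r -> r <= s -> g s <= g r.
Proof.
move=> r0 rs; apply: (is_derive_le dg rs) => z rz.
exact/ltW/ode_decreasing/(lt_trans r0).
Qed.

(** [ode_slope] bounds [- v] only from below; the mean value theorem gives an upper bound at one
    point of each interval from [r] to [2 r], where [g (2 r) > 0] is dropped. *)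
Let slope_point r : 0 < r -> exists s, [/\ r < s, s < 2 * r & - v s * r <= g r].
Proof.
move=> r0; have r2r : r < 2 * r by lra.
have [s] := MVT r2r (fun z _ => dg z) (is_derive_within_continuous dg).
rewrite in_itv /= => /andP[rs sr] E; exists s; split=> //.
by have := g0 (2 * r); lra.
Qed.

Let energy_ge0 r : 0 < r -> 0 <= energy r.
Proof.
move=> r0; rewrite addr_ge0 ?subr_ge0 ?(ltW (Q_gt1 r0))//.
by rewrite mulr_ge0 ?powR_ge0// invr_ge0; have := p1; lra.
Qed.

Let decay_inv r : 0 < r -> r ^+ 2 * g r `^ (p - 1) <= c0^-1.
Proof.
move=> r0; have := ode_decay (ltW r0).
rewrite -(ler_pM2r (gp r (p - 1))) -gD (_ : 1 - p + (p - 1) = 0); last by ring.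
rewrite powRr0 -mulrA => h.
by rewrite -(ler_pM2l c0_gt0) divff// gt_eqF.
Qed.

(** The kinetic part satisfies [Q - 1 <= Q^2 - 1 = (Q v)^2], which [Kb] and the slope hypothesis
    control. In the potential part, [g^(p+1) = g^(p-1) g^2] and the decay absorbs [r^2 g^(p-1)]. *)
Let energy_bound r s : 0 < r -> r <= s -> - v s * r <= g r ->
  r ^+ 2 * energy s <= (Kb ^+ 2 + c0^-1) * g r ^+ 2.
Proof.
move=> r0 rs vs; have s0 := lt_le_trans r0 rs.
rewrite mulrDr mulrDl lerD//.
  have Q1 := Q_gt1 s0; have QK := ode_lorentz_bound (ltW s0).
  have v0 := ode_decreasing s0.
  have h1 : Q s - 1 <= (Q s * v s) ^+ 2 by have := Qv s; nra.
  have h2 : (Q s * (- v s * r)) ^+ 2 <= (Kb * g r) ^+ 2.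
    rewrite ler_sqr ?nnegrE ?mulr_ge0 ?oppr_ge0 ?(ltW v0) ?(ltW (Q0 _)) ?(ltW (g0 _))
      ?(ltW r0) ?(ltW Kb0)//.
    by rewrite ler_pM ?mulr_ge0 ?oppr_ge0 ?(ltW v0) ?(ltW r0) ?(ltW (Q0 _)).
  rewrite -exprMn; apply: le_trans h2.
  have -> : (Q s * (- v s * r)) ^+ 2 = r ^+ 2 * (Q s * v s) ^+ 2 by ring.
  by rewrite ler_pM2l ?exprn_gt0.
have pp : 0 < p + 1 by have := p1; lra.
apply: (@le_trans _ _ (r ^+ 2 * g r `^ (p + 1))).
  rewrite ler_pM2l ?exprn_gt0//.
  apply: (@le_trans _ _ (g s `^ (p + 1))).
    by rewrite ler_piMl ?powR_ge0// invf_le1//; have := p1; lra.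
  by rewrite ge0_ler_powR ?nnegrE ?g_noninc// ltW.
have -> : p + 1 = (p - 1) + 2 by ring.
by rewrite gD mulrA (powR_mulrn 2) ?(ltW (g0 r))// ler_pM2r ?exprn_gt0// decay_inv.
Qed.

Let Cb := 2 ^+ k.+2 * (Kb ^+ 2 + c0^-1).

Let Cb_gt0 : 0 < Cb.
Proof. by rewrite mulr_gt0 ?exprn_gt0 ?addr_gt0 ?exprn_gt0 ?invr_gt0. Qed.

(** Monotonicity passes from 1 to the point [s] of [slope_point]. There the negative flux term is
    discarded, and [s < 2 r] costs the factor [2^(k+2)] in [Cb]. *)
Let pohozaev_bound r : 1 <= r -> pohozaev 1 <= Cb * (r ^+ k * g r ^+ 2).
Proof.
move=> r1; have r0 : 0 < r by lra.
have [s [rs sr vs]] := slope_point r0.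
have s0 := lt_trans r0 rs.
apply: (le_trans (ltW (ode_pohozaev_increasing ler01 (le_lt_trans r1 rs)))).
have b0 : 0 < b by rewrite divr_gt0//; have := p1; lra.
apply: (@le_trans _ _ (s ^+ k.+2 * energy s)).
  by rewrite /pohozaev gerDl pmulr_rle0// mulr_le0_ge0 ?(ltW (flux_lt0 s0)) ?(ltW (g0 s)).
apply: (@le_trans _ _ ((2 * r) ^+ k.+2 * energy s)).
  by rewrite ler_wpM2r ?energy_ge0// lerXn2r ?nnegrE ?ltW// mulr_gt0.
have -> : (2 * r) ^+ k.+2 * energy s = 2 ^+ k.+2 * r ^+ k * (r ^+ 2 * energy s).
  by rewrite exprMn -(addn2 k) (exprD r) -!mulrA.
have -> : Cb * (r ^+ k * g r ^+ 2) =
  2 ^+ k.+2 * r ^+ k * ((Kb ^+ 2 + c0^-1) * g r ^+ 2) by rewrite /Cb mulrACA !mulrA.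
rewrite ler_wpM2l//; last exact: energy_bound (ltW rs) vs.
by rewrite mulr_ge0// exprn_ge0// ltW.
Qed.

Let e := (p - 1) / 2.
Let M := Cb `^ e / (pohozaev 1 `^ e * c0).
Let kappa := 2 - k%:R * e.

(** The exponent [e] turns [g^2] into [g^(p-1)], so [pohozaev_bound] raised to the power [e]
    combines with [g^(p-1) <= 1 / (c0 r^2)] and leaves only a power of [r]. *)
Let power_bound r : 1 <= r -> r `^ kappa <= M.
Proof.
move=> r1; have r0 : 0 < r by lra.
have e0 : 0 <= e by rewrite divr_ge0// subr_ge0 ltW.
have d0 : 0 < pohozaev 1 `^ e * c0 by rewrite mulr_gt0 ?powR_gt0.
have le_e : pohozaev 1 `^ e <= Cb `^ e * (r `^ (k%:R * e) * g r `^ (p - 1)).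
  have rk0 : 0 <= r ^+ k by rewrite exprn_ge0// ltW.
  have gg0 : 0 <= g r ^+ 2 by exact: sqr_ge0.
  have C0 : 0 <= Cb by exact: ltW.
  have rg0 : 0 <= r ^+ k * g r ^+ 2 by exact: mulr_ge0.
  have -> : r `^ (k%:R * e) = (r ^+ k) `^ e by rewrite powRrM powR_mulrn// ltW.
  have -> : g r `^ (p - 1) = (g r ^+ 2) `^ e.
    by rewrite (_ : p - 1 = 2%:R * e) ?powRrM ?powR_mulrn ?ltW//; rewrite /e; field.
  rewrite -powRM// -powRM//.
  apply: (ge0_ler_powR e0); rewrite ?nnegrE.
  - exact: ltW.
  - exact: mulr_ge0.
  - exact: pohozaev_bound.
rewrite /M ler_pdivlMr// powRB ?(gt_eqF r0) ?implybT// (powR_mulrn 2) ?(ltW r0)//.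
set x := r `^ (k%:R * e) in le_e *; have x0 : 0 < x by rewrite powR_gt0.
rewrite -mulrAC ler_pdivrMr//.
have h : c0 * (r ^+ 2 * g r `^ (p - 1)) <= 1.
  by have := decay_inv r0; rewrite -(ler_pM2l c0_gt0) divff// gt_eqF.
have := ler_wpM2r (mulr_ge0 (ltW c0_gt0) (sqr_ge0 r)) le_e.
have -> : Cb `^ e * (x * g r `^ (p - 1)) * (c0 * r ^+ 2) =
  Cb `^ e * x * (c0 * (r ^+ 2 * g r `^ (p - 1))) by ring.
have := ler_wpM2l (mulr_ge0 (powR_ge0 Cb e) (ltW x0)) h.
by rewrite mulr1; lra.
Qed.

Lemma ode_no_solution : False.
Proof.
have M0 : 0 <= M by exact: le_trans (powR_ge0 _ _) (power_bound (lexx 1)).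
(* Subcriticality again: [kappa > 0] is [pk] rearranged. The radius chosen next has
   [r^kappa = M + 1]. *)
have k0 : 0 < kappa by rewrite /kappa /e; have := pk; lra.
have := @power_bound ((M + 1) `^ kappa^-1).
rewrite -powRrM mulVf ?gt_eqF// powRr1; last by lra.
have r1 : 1 <= (M + 1) `^ kappa^-1.
  by rewrite -[leLHS](powRr0 (M + 1)) ler_powR ?invr_ge0 ?(ltW k0)//; lra.
by move=> /(_ r1); lra.
Qed.

End RadialODE.

(** * Derivatives along lines and the Euclidean norm *)

Lemma is_derive_line (R : realType) (V : normedModType R) (f : V -> R)
    (x w : V) (r d : R) :
  is_derive (x + r *: w) w f d <-> is_derive r 1 (fun t => f (x + t *: w)) d.
Proof.
have E : (fun h : R => h^-1 *: ((f \o shift (x + r *: w)) (h *: w) - f (x + r *: w))) =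
    (fun h : R => h^-1 *: (((fun t => f (x + t *: w)) \o shift r) (h *: 1) -
      f (x + r *: w))).
  apply/boolp.funext => h /=; congr (_ *: (f _ - _)).
  by rewrite (_ : h *: (1 : R) = h) ?scalerDl 1?addrCA//; exact: mulr1.
have Eder : derivable f (x + r *: w) w = derivable (fun t : R => f (x + t *: w)) r 1.
  by rewrite /derivable E.
have ED : 'D_w f (x + r *: w) = 'D_1 (fun t : R => f (x + t *: w)) r by rewrite /derive E.
split=> -[D1 D2]; split; first by rewrite -Eder.
- by rewrite -ED.
- by rewrite Eder.
- by rewrite ED.
Qed.

Section EuclideanNorm.
Set Implicit Arguments.
Unset Strict Implicit.
Variables (R : realType) (N : nat).
Implicit Types (x : 'rV[R]_N) (i : 'I_N).

Lemma sqr_enorm x : enorm x ^+ 2 = \sum_(j < N) x 0 j ^+ 2.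
Proof. by rewrite sqr_sqrtr// sumr_ge0// => j _; exact: sqr_ge0. Qed.

Lemma enorm_ge0 x : 0 <= enorm x. Proof. exact: sqrtr_ge0. Qed.

Lemma sqr_enorm_line x i t :
  enorm (x + t *: delta_mx 0 i) ^+ 2 = enorm x ^+ 2 + 2 * t * x 0 i + t ^+ 2.
Proof.
rewrite !sqr_enorm (bigD1 i)//= [in RHS](bigD1 i)//= !mxE !eqxx mulr1.
rewrite (eq_bigr (fun j => x 0 j ^+ 2)); first by ring.
by move=> j /negPf ji; rewrite !mxE eqxx ji mulr0 addr0.
Qed.

Lemma enormZ_delta i (r : R) : 0 <= r -> enorm (r *: delta_mx 0 i : 'rV[R]_N) = r.
Proof.
move=> r0; apply/eqP; rewrite -(eqrXn2 (n := 2))// ?enorm_ge0//.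
rewrite -[_ *: _]add0r sqr_enorm_line sqr_enorm big1 ?mxE ?mulr0 ?add0r//.
by move=> j _; rewrite mxE expr0n.
Qed.

Lemma is_derive_enorm x i : 0 < enorm x ->
  is_derive (0 : R) 1 (fun t : R => enorm (x + t *: delta_mx 0 i)) (x 0 i / enorm x).
Proof.
move=> x0.
have -> : (fun t : R => enorm (x + t *: delta_mx 0 i)) =
    (fun t : R => Num.sqrt (enorm x ^+ 2 + (2 * x 0 i) * t + t ^+ 2)).
  apply/boolp.funext => t; rewrite -[LHS]ger0_norm ?enorm_ge0// -sqrtr_sqr.
  by rewrite sqr_enorm_line mulrAC.
set S := fun t : R => enorm x ^+ 2 + (2 * x 0 i) * t + t ^+ 2.
have dS : is_derive (0 : R) 1 S (2 * x 0 i).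
  have := is_derive_add (is_derive_add (is_derive_cst (enorm x ^+ 2) (0 : R) 1)
    (is_derive_scale (2 * x 0 i) (is_derive_id (0 : R) 1))) (is_derive_pow 2 0).
  by move/is_derive_eq; apply; rewrite expr1 mulr0 addr0 add0r mulr1.
have S0 : S 0 = enorm x ^+ 2 by rewrite /S mulr0 expr0n/= !addr0.
have S0p : 0 < S 0 by rewrite S0 exprn_gt0.
have := @is_derive1_comp _ Num.sqrt S _ _ _ (is_derive1_sqrt S0p) dS.
move/is_derive_eq; apply.
rewrite S0 sqrtr_sqr ger0_norm ?enorm_ge0//.
by field; rewrite gt_eqF.
Qed.

End EuclideanNorm.

(** * From the partial differential equation to the radial one *)

Section RadialReduction.
Set Implicit Arguments.
Unset Strict Implicit.
Variables (R : realType) (k : nat) (p : R) (u : 'rV[R]_k.+2 -> R).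
Hypotheses (su : is_classical_solution p u) (ru : radial u).
Implicit Types (r t : R) (x : 'rV[R]_k.+2) (i : 'I_k.+2).

(** The profile is read off along a full coordinate axis, not taken from the witness of [radial],
    which is arbitrary at negative arguments. Thus [g] inherits the regularity of [u] at every real
    [r], including 0. *)
Let axis : 'rV[R]_k.+2 := delta_mx 0 0.
Let g r := u (r *: axis).
Let v r := partial 0 u (r *: axis).
Let a r := partial 0 (partial 0 u) (r *: axis).
Let Q r := (Num.sqrt (1 - v r ^+ 2))^-1.

Let dg r : is_derive r 1 g (v r).
Proof.
have [[_ +] _ _ _ _] := su => /(_ 0)[du _].
have := du (r *: axis) => /derivableP; rewrite -{1}[r *: axis]add0r.
move/is_derive_line; rewrite /g.
by under boolp.eq_fun do rewrite add0r.
Qed.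

Let dv r : is_derive r 1 v (a r).
Proof.
have [[_ +] _ _ _ _] := su => /(_ 0)[_ [_ /(_ 0)[du _]]].
have := du (r *: axis) => /derivableP; rewrite -{1}[r *: axis]add0r.
move/is_derive_line; rewrite /v.
by under boolp.eq_fun do rewrite add0r.
Qed.

Let v_lt1 r : 0 < 1 - v r ^+ 2.
Proof.
have [_ /(_ (r *: axis)) h _ _ _] := su.
rewrite subr_gt0 -(expr1n _ 2).
apply: (@le_lt_trans _ _ (enorm (grad u (r *: axis)) ^+ 2)); last first.
  by rewrite ltr_sqr ?nnegrE ?enorm_ge0.
rewrite sqr_enorm (bigD1 0)//= mxE lerDl sumr_ge0// => j _; exact: sqr_ge0.
Qed.

Let Q_gt0 r : 0 < Q r. Proof. by rewrite invr_gt0 sqrtr_gt0. Qed.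

Let QvE r : Q r ^+ 2 * (1 - v r ^+ 2) = 1.
Proof. by rewrite exprVn sqr_sqrtr ?ltW// mulVf// gt_eqF. Qed.

Let dQ r : is_derive r 1 Q (v r * a r * Q r ^+ 3).
Proof.
have dW : is_derive r 1 (fun s => 1 + -1 * (v s * v s)) (- 2 * v r * a r).
  have := is_derive_add (is_derive_cst (1 : R) r 1)
    (is_derive_scale (-1) (is_derive_mul (dv r) (dv r))).
  by move/is_derive_eq; apply; ring.
have W0 : 0 < 1 + -1 * (v r * v r) by rewrite mulN1r -expr2.
have dsW := @is_derive1_comp _ Num.sqrt (fun s => 1 + -1 * (v s * v s)) _ _ _ (is_derive1_sqrt W0) dW.
have sW0 : Num.sqrt (1 + -1 * (v r * v r)) != 0 by rewrite gt_eqF// sqrtr_gt0.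
have -> : Q = (fun s => (Num.sqrt (1 + -1 * (v s * v s)))^-1).
  by apply/boolp.funext => s; rewrite /Q mulN1r -expr2.
have := @is_deriveV _ (fun s => Num.sqrt (1 + -1 * (v s * v s))) _ _ _ sW0 dsW; move/is_derive_eq; apply => /=.
rewrite /GRing.scale /=; set w := Num.sqrt _ in sW0 *.
by field.
Qed.

Let uE x : u x = g (enorm x).
Proof. by have [f fE] := ru; rewrite /g !fE enormZ_delta// enorm_ge0. Qed.

Let partialE i x : 0 < enorm x -> partial i u x = v (enorm x) * (x 0 i / enorm x).
Proof.
move=> x0; apply: derive_val.
rewrite -{1}[x]addr0 -(scale0r (delta_mx 0 i)); apply/is_derive_line.
under boolp.eq_fun do rewrite uE.
have dx := is_derive_enorm i x0.
apply: (@is_derive1_comp _ g (fun t => enorm (x + t *: delta_mx 0 i))).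
by rewrite scale0r addr0.
Qed.

Let fluxE i x : 0 < enorm x ->
  mean_curvature_flux u x 0 i = v (enorm x) * Q (enorm x) * (x 0 i / enorm x).
Proof.
move=> x0; rewrite /mean_curvature_flux !mxE partialE//.
suff -> : enorm (grad u x) ^+ 2 = v (enorm x) ^+ 2 by rewrite -/(Q _); ring.
rewrite sqr_enorm.
under eq_bigr do rewrite mxE partialE// !exprMn exprVn.
rewrite -mulr_sumr -mulr_suml -sqr_enorm mulfV ?mulr1//.
by rewrite expf_neq0// gt_eqF.
Qed.

(** Along the axis the radial factor [v Q] is differentiated. In a transverse direction [|x|] is
    stationary, and only the factor [x_i / |x|] contributes, with slope [1 / r]. *)
Let dflux i r : 0 < r ->
  partial i (fun y => mean_curvature_flux u y 0 i) (r *: axis) =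
  if i == 0 then a r * Q r ^+ 3 else (v r * Q r) / r.
Proof.
move=> r0; set x := r *: axis.
have xE : enorm x = r by rewrite enormZ_delta// ltW.
have x0 : 0 < enorm x by rewrite xE.
apply: derive_val.
rewrite -{1}[x]addr0 -(scale0r (delta_mx 0 i)); apply/is_derive_line.
set rho := fun t => enorm (x + t *: delta_mx 0 i).
have rho0 : rho 0 = r by rewrite /rho scale0r addr0.
have drho : is_derive (0 : R) 1 rho (x 0 i / r) by rewrite -[in _ / r]xE; exact: is_derive_enorm.
pose F t := v (rho t) * Q (rho t) * ((x 0 i + t) * (rho t)^-1).
(* The formula [fluxE] holds only off the origin, hence agreement with [F] is claimed just for [t]
   near 0. *)
apply: (@near_eq_is_derive _ _ _ F).
  have crho : {for 0, continuous rho}.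
    exact/differentiable_continuous/derivable1_diffP/(@ex_derive _ _ _ _ _ _ _ drho).
  have rho_gt0 : \forall t \near (0 : R), 0 < rho t.
    by apply: (cvgr_gt (rho 0) crho); rewrite rho0.
  near=> t.
  rewrite fluxE; last by near: t.
  by rewrite /F !mxE !eqxx mulr1.
have dphi : is_derive (rho 0) 1 (fun s => v s * Q s) (a r * Q r ^+ 3).
  have := is_derive_mul (dv (rho 0)) (dQ (rho 0)); rewrite rho0.
  move/is_derive_eq; apply.
  have -> : a r * Q r = a r * Q r * (Q r ^+ 2 * (1 - v r ^+ 2)) by rewrite QvE mulr1.
  by ring.
have drhoV : is_derive (0 : R) 1 (fun t => (rho t)^-1) (- (rho 0) ^- 2 *: (x 0 i / r)).
  by apply: is_deriveV; rewrite rho0 gt_eqF.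
have dt : is_derive (0 : R) 1 (fun t => x 0 i + t) (0 + 1).
  exact: is_derive_add (is_derive_cst (x 0 i) (0 : R) 1) (is_derive_id (0 : R) 1).
have := is_derive_mul (@is_derive1_comp _ (fun s => v s * Q s) rho _ _ _ dphi drho)
  (is_derive_mul dt drhoV).
move/is_derive_eq; apply; rewrite /= rho0 /GRing.scale /= !mxE eqxx /=.
by case: eqP => _ /=; field; rewrite gt_eqF.
Unshelve. all: by end_near.
Qed.

(** The divergence on the axis has one axial term and [k + 1] equal transverse terms. *)
Lemma radial_ode r : 0 < r ->
  a r * Q r ^+ 3 + k.+1%:R / r * (v r * Q r) + g r `^ p = 0.
Proof.
move=> r0; have [_ _ /(_ (r *: axis)) + _ _] := su.
rewrite /div; under eq_bigr do rewrite dflux//.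
rewrite big_ord_recl eqxx.
under eq_bigr do rewrite /=.
by rewrite sumr_const card_ord -[_ / r *+ _]mulr_natl -[_ / r * _]mulrA [r^-1 * _]mulrC.
Qed.

Lemma radial_solution_absurd : 1 < p -> p * k%:R < k%:R + 4 -> False.
Proof.
move=> p1 pk.
apply: (ode_no_solution p1 pk dg dv dQ _ Q_gt0 QvE radial_ode) => r.
by have [_ _ _ + _] := su; apply.
Qed.

End RadialReduction.

Theorem theorem0p1 (R : realType) (N : nat) (p : R)
    (hN : (3 <= N)%N) (hp1 : 1 < p) (hp2 : p < (N%:R + 2) / (N%:R - 2)) :
  ~ exists u : 'rV[R]_N -> R, is_classical_solution p u /\ radial u.
Proof.
case: N hN hp2 => [//|[//|[//|k]]] _ hp2 [u [su ru]].
apply: (radial_solution_absurd su ru hp1).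
(* Here N is [k + 3], so [k + 1 = N - 2 > 0]; clearing the denominator gives
   [p (N - 2) < (N - 2) + 4]. *)
have k1 : 0 < k.+1%:R :> R by rewrite ltr0n.
move: hp2; rewrite -(addn2 k.+1) natrD addrK ltr_pdivlMr//; lra.
Qed.
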